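(* Let $\Gamma$ be a non-elementary geometrically finite Kleinian group containing parabolic elements, with limit set $L(\Gamma)$, set of parabolic fixed points $P$, standard horoballs $\{H_p\}_{p\in P}$, Poincaré exponent $\delta$ and Patterson–Sullivan measure $\mu_\delta$. For each $s>\delta$ let $\mu_s$ be the $s$-conformal measure described in the context. Fix an admissible pair $(\tau,C)\in(0,1)^2$ (as defined in the context). Then there exist $R_0>0$ and $A\geq 1$, depending only on $\Gamma$ and $\tau$ (with $C$ the constant fixed together with $\tau$) and in particular not on $s$, $z$ or $R$, such that for all $s>\delta$, all $z\in L(\Gamma)$ and all $R\in(0,R_0)$, setting $$G_s(z,R)=R^{2(s-\delta)}\mu_\delta(B(z,R))\;+\sum_{\substack{k\in\mathbb{N}:\\ CR^2\leq\tau^k<R}}\#\left\{p\in P\cap B(z,R)\;\middle|\;\tau^{k+1}\leq|H_p|<\tau^k\right\}\tau^{ks}\;+\;|H_{p'}|^s,$$ we have $$A^{-1}\,G_s(z,R)\leq\mu_s(B(z,R))\leq A\,G_s(z,R).$$ Here $p'\in P\cap B(z,R)$ is chosen to maximise $|H_{p'}|$ among those points of $P\cap B(z,R)$ satisfying $|H_{p'}|\geq\tau^k$ for all integers $k$ with $\tau^k<R$; if no such $p'$ exists, then $|H_{p'}|^s$ is taken to be $0$.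
   Context: Setting: $d\geq 1$; $\mathbb{D}^{d+1}=\{z\in\mathbb{R}^{d+1}: |z|<1\}$ is the Poincaré ball model with metric $d_{\mathbb H}$ given by $ds=2|dz|/(1-|z|^2)$, with boundary at infinity $\mathbb{S}^d=\{z\in\mathbb{R}^{d+1}:|z|=1\}$; $\mathbf{0}$ is the origin. $\Gamma$ is a non-elementary geometrically finite (in the sense of Bowditch) Kleinian group acting on $\mathbb{D}^{d+1}$ which contains parabolic elements (elements fixing precisely one point in $\mathbb{S}^d$). $L(\Gamma)=\overline{\Gamma(\mathbf{0})}\setminus\Gamma(\mathbf{0})$ is the limit set and $P\subseteq L(\Gamma)$ is the countable set of parabolic fixed points. Standard horoballs: $\{H_p\}_{p\in P}$ is a fixed family where $H_p$ is a horoball at $p$ (a Euclidean ball with interior contained in $\mathbb{D}^{d+1}$, tangent to $\mathbb{S}^d$ at $p$), such that the horoballs are pairwise disjoint, do not contain $\mathbf{0}$, and $g(H_p)=H_{g(p)}$ for all $g\in\Gamma$, $p\in P$. (Such a family exists.) Poincaré exponent: $\delta=\inf\{s>0:\sum_{g\in\Gamma}e^{-s\,d_{\mathbb H}(\mathbf{0},g(\mathbf{0}))}<\infty\}$. For $s>0$, a Borel probability measure $\mu$ is $s$-conformal for $\Gamma$ if $\mu(g(E))=\int_E|g'|^s\,d\mu$ for all $g\in\Gamma$ and all Borel $E\subseteq\mathbb{S}^d$. $\mu_\delta$ is the (fixed) Patterson–Sullivan measure of $\Gamma$, a $\delta$-conformal Borel probability measure supported on $L(\Gamma)$. For each $s>\delta$,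 $\mu_s$ is an $s$-conformal measure supported on $L(\Gamma)$ (existence due to Sullivan); it is purely atomic with atoms at the points of $P$, and, as taken throughout, $\mu_s(\{p\})$ is uniformly comparable to $|H_p|^s$ for $p\in P$ (comparability constants depending only on $\Gamma$). Admissible pair: $(\tau,C)\in(0,1)^2$ is admissible if there exist $R_1>0$ and $A_1\geq 1$ such that for all $z\in L(\Gamma)$, all $R\in(0,R_1)$ and all $k\in\mathbb{N}$ with $\tau^k<CR^2$, $$A_1^{-1}\tau^{-k\delta}\mu_\delta(B(z,R))\leq\#\{p\in P\cap B(z,R):\tau^{k+1}\leq|H_p|<\tau^k\}\leq A_1\tau^{-k\delta}\mu_\delta(B(z,R)),$$ where $A_1$ depends only on $\Gamma$ and $\tau$. (For every sufficiently small $\tau\in(0,1)$ there is $C\in(0,1)$ such that $(\tau,C)$ is admissible.) Notation: $B(z,r)$ is the closed Euclidean ball of centre $z$ and radius $r$; $|X|$ is the Euclidean diameter of a set $X$.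
   Formalization: No single comparability constant between μ_s({p}) and |H_p|^s can serve all s>δ, as μ_s are probability measures; here a constant A_0 is fixed first, R_0 and A may depend on it, and the bounds are claimed for all s>δ and μ_s whose atoms are comparable with constant A_0. *)

(* Defs.v *)
From HB Require Import structures.
From mathcomp Require Import all_boot all_order all_algebra.
From mathcomp Require Import all_classical all_reals all_analysis.

Set Implicit Arguments.
Unset Strict Implicit.
Unset Printing Implicit Defensive.

Import Order.TTheory GRing.Theory Num.Theory numFieldNormedType.Exports.

Local Open Scope classical_set_scope.
Local Open Scope ring_scope.

(* The library norm on row vectors is the sup norm: it is used here only for   *)
(* the topology and for derivatives of curves. All distances, balls and        *)
(* diameters use the Euclidean norm enorm.                                     *)
Definition enorm (R : realType) (n : nat) (x : 'rV[R]_n) : R :=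
  Num.sqrt (\sum_(i < n) x 0 i ^+ 2).

Definition eball (R : realType) (n : nat) (z : 'rV[R]_n) (r : R) :
  set 'rV[R]_n := [set x | enorm (x - z) <= r].

Definition ediam (R : realType) (n : nat) (X : set 'rV[R]_n) : R :=
  sup [set enorm (x - y) | x in X & y in X].

Definition disc (R : realType) (n : nat) : set 'rV[R]_n :=
  [set x | enorm x < 1].

Definition sphere (R : realType) (n : nat) : set 'rV[R]_n :=
  [set x | enorm x = 1].

Arguments disc {R n}.
Arguments sphere {R n}.

(* A C^1 curve on [0, 1] extends to a C^1 curve on the whole line, so no       *)
(* generality is lost by asking for regularity everywhere.                     *)
Definition hcurve (R : realType) (d : nat) (x y : 'rV[R]_d.+1)
    (c : R -> 'rV[R]_d.+1) : Prop :=
  [/\ (forall t, derivable c t 1), continuous (derive1 c),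
      (forall t, 0 <= t <= 1 -> disc (c t)), c 0 = x & c 1 = y].

Definition hlength (R : realType) (d : nat) (c : R -> 'rV[R]_d.+1) : R :=
  Rintegral lebesgue_measure `[0, 1]
    (fun t => 2 * enorm (derive1 c t) / (1 - enorm (c t) ^+ 2)).

Definition hdist (R : realType) (d : nat) (x y : 'rV[R]_d.+1) : R :=
  inf [set hlength c | c in hcurve x y].

(* An isometry of the disc together with its continuous extension to the       *)
(* closed ball, where it is determined by its values on the disc. Outside the  *)
(* closed ball the function is the identity, so that equality of functions is  *)
(* equality of isometries and sums over a group count each element once.       *)
Definition hisometry (R : realType) (d : nat)
    (g : 'rV[R]_d.+1 -> 'rV[R]_d.+1) : Prop :=
  [/\ g @` disc = disc,
      (forall x y, disc x -> disc y -> hdist (g x) (g y) = hdist x y),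
      {within eball 0 1, continuous g} &
      (forall x, 1 < enorm x -> g x = x)].

(* Discreteness is that of the compact-open topology on isometries of disc.    *)
Definition kleinian (R : realType) (d : nat)
    (G : set ('rV[R]_d.+1 -> 'rV[R]_d.+1)) : Prop :=
  [/\ (forall g, G g -> hisometry g),
      G id,
      (forall g h, G g -> G h -> G (g \o h)),
      (forall g, G g -> exists2 h, G h & g \o h = id /\ h \o g = id) &
      (forall h, G h -> exists K : set 'rV[R]_d.+1, exists e : R,
        [/\ compact K, K `<=` disc, 0 < e &
            forall g, G g ->
              (forall x, K x -> hdist (g x) (h x) < e) -> g = h])].

Definition orbit0 (R : realType) (d : nat)
    (G : set ('rV[R]_d.+1 -> 'rV[R]_d.+1)) : set 'rV[R]_d.+1 :=
  [set g 0 | g in G].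

Definition limit_set (R : realType) (d : nat)
    (G : set ('rV[R]_d.+1 -> 'rV[R]_d.+1)) : set 'rV[R]_d.+1 :=
  closure (orbit0 G) `\` orbit0 G.

Definition non_elementary (R : realType) (d : nat)
    (G : set ('rV[R]_d.+1 -> 'rV[R]_d.+1)) : Prop :=
  forall a b, ~ (limit_set G `<=` [set a; b]).

Definition parabolic_at (R : realType) (d : nat)
    (g : 'rV[R]_d.+1 -> 'rV[R]_d.+1) (p : 'rV[R]_d.+1) : Prop :=
  sphere `&` [set x | g x = x] = [set p].

Definition parabolic_points (R : realType) (d : nat)
    (G : set ('rV[R]_d.+1 -> 'rV[R]_d.+1)) : set 'rV[R]_d.+1 :=
  [set p | exists2 g, G g & parabolic_at g p].

(* Orbit points converge to z within bounded distance of a geodesic ray ending *)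
(* at z; the ray starting at the origin is the Euclidean radius.               *)
Definition conical (R : realType) (d : nat)
    (G : set ('rV[R]_d.+1 -> 'rV[R]_d.+1)) (z : 'rV[R]_d.+1) : Prop :=
  exists r : R, forall e : R, 0 < e -> exists g : 'rV[R]_d.+1 -> 'rV[R]_d.+1,
    [/\ G g, enorm (g 0 - z) < e &
        exists2 t : R, 0 <= t < 1 & hdist (g 0) (t *: z) <= r].

(* The stabiliser of p acts cocompactly on the limit set minus p.              *)
Definition bounded_parabolic (R : realType) (d : nat)
    (G : set ('rV[R]_d.+1 -> 'rV[R]_d.+1)) (p : 'rV[R]_d.+1) : Prop :=
  parabolic_points G p /\
  exists K : set 'rV[R]_d.+1,
    [/\ compact K, K `<=` limit_set G `\ p &
        limit_set G `\ p `<=` \bigcup_(g in [set g | G g /\ g p = p]) (g @` K)].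

(* Bowditch's condition GF2 (due to Beardon and Maskit).                       *)
Definition geometrically_finite (R : realType) (d : nat)
    (G : set ('rV[R]_d.+1 -> 'rV[R]_d.+1)) : Prop :=
  forall z, limit_set G z -> conical G z \/ bounded_parabolic G z.

Definition horoball (R : realType) (d : nat) (p : 'rV[R]_d.+1)
    (B : set 'rV[R]_d.+1) : Prop :=
  [/\ (exists c : 'rV[R]_d.+1, exists2 r : R, 0 < r & B = eball c r),
      interior B `<=` disc & B `&` sphere = [set p]].

Definition standard_horoballs (R : realType) (d : nat)
    (G : set ('rV[R]_d.+1 -> 'rV[R]_d.+1))
    (H : 'rV[R]_d.+1 -> set 'rV[R]_d.+1) : Prop :=
  [/\ (forall p, parabolic_points G p -> horoball p (H p)),
      (forall p q, parabolic_points G p -> parabolic_points G q -> p <> q ->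
         H p `&` H q = set0),
      (forall p, parabolic_points G p -> ~ H p 0) &
      (forall g p, G g -> parabolic_points G p -> g @` H p = H (g p))].

Definition poincare_exponent (R : realType) (d : nat)
    (G : set ('rV[R]_d.+1 -> 'rV[R]_d.+1)) : R :=
  inf [set s : R | 0 < s /\
    (\esum_(g in G) (expR (- s * hdist 0 (g 0)))%:E < +oo)%E].

(* |g'(x)| as the local Euclidean scaling factor of the conformal map g on the *)
(* sphere.                                                                     *)
Definition conf_deriv (R : realType) (d : nat)
    (g : 'rV[R]_d.+1 -> 'rV[R]_d.+1) (x : 'rV[R]_d.+1) : R :=
  lim ((fun y => enorm (g y - g x) / enorm (y - x)) @ within sphere x^').

Notation borel R d := (g_sigma_algebraType (@open 'rV[R]_d.+1)).

(* Borel measures on the sphere are Borel measures on the ambient space for    *)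
(* which the complement of the sphere is null; supported_on ensures this below.*)
Definition conformal (R : realType) (d : nat)
    (G : set ('rV[R]_d.+1 -> 'rV[R]_d.+1)) (s : R)
    (mu : probability (borel R d) R) : Prop :=
  forall g (E : set (borel R d)), G g -> measurable E -> E `<=` sphere ->
    mu (g @` E) = (\int[mu]_(x in E) (conf_deriv g x `^ s)%:E)%E.

Definition supported_on (R : realType) (d : nat) (X : set 'rV[R]_d.+1)
    (mu : probability (borel R d) R) : Prop :=
  mu (~` X) = 0%E.

Definition purely_atomic_on (R : realType) (d : nat) (X : set 'rV[R]_d.+1)
    (mu : probability (borel R d) R) : Prop :=
  mu (~` X) = 0%E /\ forall p, X p -> (0 < mu [set p])%E.

(* A0 is a parameter, to be fixed together with the group: with a single A0    *)
(* for all large s, or for all s near the Poincare exponent, no probability    *)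
(* measure mu satisfies this, so it must not be required of every s at once.   *)
Definition atoms_comparable (R : realType) (d : nat)
    (G : set ('rV[R]_d.+1 -> 'rV[R]_d.+1))
    (H : 'rV[R]_d.+1 -> set 'rV[R]_d.+1) (A0 s : R)
    (mu : probability (borel R d) R) : Prop :=
  forall p, parabolic_points G p ->
    ((A0^-1 * ediam (H p) `^ s)%:E <= mu [set p] /\
     mu [set p] <= (A0 * ediam (H p) `^ s)%:E)%E.

Definition horoball_count (R : realType) (d : nat)
    (G : set ('rV[R]_d.+1 -> 'rV[R]_d.+1))
    (H : 'rV[R]_d.+1 -> set 'rV[R]_d.+1) (tau : R) (z : 'rV[R]_d.+1) (r : R)
    (k : nat) : \bar R :=
  counting [set p | [/\ parabolic_points G p, eball z r p &
                        tau ^+ k.+1 <= ediam (H p) < tau ^+ k]].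

Definition admissible (R : realType) (d : nat)
    (G : set ('rV[R]_d.+1 -> 'rV[R]_d.+1))
    (H : 'rV[R]_d.+1 -> set 'rV[R]_d.+1)
    (mud : probability (borel R d) R) (tau C : R) : Prop :=
  exists R1 : R, exists A1 : R,
    [/\ 0 < R1, 1 <= A1 &
      forall (z : 'rV[R]_d.+1) (r : R) (k : nat),
        limit_set G z -> 0 < r < R1 -> tau ^+ k < C * r ^+ 2 ->
        let w := tau `^ (- (k%:R * poincare_exponent G)) in
        ((A1^-1 * w)%:E * mud (eball z r) <= horoball_count G H tau z r k /\
         horoball_count G H tau z r k <= (A1 * w)%:E * mud (eball z r))%E].

Definition large_points (R : realType) (d : nat)
    (G : set ('rV[R]_d.+1 -> 'rV[R]_d.+1))
    (H : 'rV[R]_d.+1 -> set 'rV[R]_d.+1) (tau : R) (z : 'rV[R]_d.+1) (r : R) :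
  set 'rV[R]_d.+1 :=
  [set p | [/\ parabolic_points G p, eball z r p &
               forall k : int, tau ^ k < r -> tau ^ k <= ediam (H p)]].

(* All maximisers p' give the same value, and the default value 0 of xget is   *)
(* used exactly when there is no p'.                                           *)
Definition large_term (R : realType) (d : nat)
    (G : set ('rV[R]_d.+1 -> 'rV[R]_d.+1))
    (H : 'rV[R]_d.+1 -> set 'rV[R]_d.+1) (tau s : R) (z : 'rV[R]_d.+1)
    (r : R) : R :=
  xget 0 [set ediam (H p') `^ s | p' in
    [set p' | large_points G H tau z r p' /\
      forall p, large_points G H tau z r p -> ediam (H p) <= ediam (H p')]].

Definition G_s (R : realType) (d : nat)
    (G : set ('rV[R]_d.+1 -> 'rV[R]_d.+1))
    (H : 'rV[R]_d.+1 -> set 'rV[R]_d.+1)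
    (mud : probability (borel R d) R) (tau C s : R) (z : 'rV[R]_d.+1)
    (r : R) : \bar R :=
  ((r `^ (2 * (s - poincare_exponent G)))%:E * mud (eball z r)
   + \esum_(k in [set k : nat | (C * r ^+ 2 <= tau ^+ k < r)%R])
       (horoball_count G H tau z r k * (tau `^ (k%:R * s))%:E)
   + (large_term G H tau s z r)%:E)%E.

(* Main.v *)
(* The measure [mu_s] lives on the parabolic points, so [mu_s (B(z, r))] is, up
   to the factor [A0], the sum of [|H_p|^s] over the parabolic points [p] of the
   ball. Sort these points by the size of [H_p].
   - Points with [|H_p| >= tau * r]: disjoint horoballs satisfy
     [|H_p| |H_q| <= |p - q|^2], so these points are [tau * r]-separated, their
     number is bounded, and the largest horoball gives the whole contribution.
   - Shells [tau^(k+1) <= |H_p| < tau^k] with [C r^2 <= tau^k < r]: these are the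
     middle sum, term by term.
   - Shells with [tau^k < C r^2]: admissibility turns their sum into
     [mu_delta (B(z, r))] times a geometric series of ratio
     [x = tau^(s - delta)], whose first term is comparable to [r^(2(s - delta))].
   The constants stay uniform because the mere existence of a probability
   measure with atoms comparable to [|H_p|^s] within the fixed factor [A0]
   confines [s]. If [x] were close to 1, the tail of the series over a ball of
   positive [mu_delta]-measure would exceed 1 (and if every small ball is
   [mu_delta]-null the tail vanishes). If [s] were much larger than another such
   exponent [s0], the mass of [mu_s] would be at most [A0^2 m^(s - s0) < 1],
   where [m < 1] bounds the diameters of the horoballs. *)
Require Import Defs.
From mathcomp Require Import all_boot all_order all_algebra.
From mathcomp Require Import all_classical all_reals all_analysis.
From mathcomp Require Import finmap ring lra.
Import Order.TTheory GRing.Theory Num.Theory numFieldNormedType.Exports.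
Local Open Scope classical_set_scope.
Local Open Scope card_scope.
Local Open Scope ring_scope.

Set Implicit Arguments.
Unset Strict Implicit.
Unset Printing Implicit Defensive.

(** * Euclidean inner product, norm and balls *)

Section Euclidean.
Context {R : realType} {n : nat}.
Implicit Types (x y z : 'rV[R]_n) (a r : R).

Definition edot x y : R := \sum_(i < n) x 0 i * y 0 i.

Lemma edotC x y : edot x y = edot y x.
Proof. by apply: eq_bigr => i _; rewrite mulrC. Qed.

Lemma edotDl x y z : edot (x + y) z = edot x z + edot y z.
Proof. by rewrite -big_split; apply: eq_bigr => i _; rewrite mxE mulrDl. Qed.

Lemma edotZl a x y : edot (a *: x) y = a * edot x y.
Proof. by rewrite [RHS]big_distrr /=; apply: eq_bigr => i _; rewrite mxE mulrA. Qed.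

Lemma edotBl x y z : edot (x - y) z = edot x z - edot y z.
Proof. by rewrite -scaleN1r edotDl edotZl mulN1r. Qed.

Lemma edotDr x y z : edot z (x + y) = edot z x + edot z y.
Proof. by rewrite !(edotC z) edotDl. Qed.

Lemma edotBr x y z : edot z (x - y) = edot z x - edot z y.
Proof. by rewrite !(edotC z) edotBl. Qed.

Lemma edotZr a x y : edot x (a *: y) = a * edot x y.
Proof. by rewrite !(edotC x) edotZl. Qed.

Definition edotE := (edotBl, edotBr, edotDl, edotDr, edotZl, edotZr).

Lemma edot_ge0 x : 0 <= edot x x.
Proof. by apply: sumr_ge0 => i _; rewrite -expr2 sqr_ge0. Qed.

Lemma edot_eq0 x : edot x x = 0 -> x = 0.
Proof.
move=> h; apply/rowP => i; rewrite mxE; apply/eqP; rewrite -(sqrf_eq0 (x 0 i)).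
apply/eqP; rewrite expr2.
have /psumr_eq0P h' := h; apply: h' => // j _.
by rewrite -expr2 sqr_ge0.
Qed.

Lemma enormE x : enorm x = Num.sqrt (edot x x).
Proof. by congr Num.sqrt; apply: eq_bigr => i _; rewrite expr2. Qed.

Lemma enorm_ge0 x : 0 <= enorm x.
Proof. exact: sqrtr_ge0. Qed.

Lemma sqr_enorm x : enorm x ^+ 2 = edot x x.
Proof. by rewrite enormE sqr_sqrtr // edot_ge0. Qed.

Lemma enorm0_eq0 x : enorm x = 0 -> x = 0.
Proof. by move=> x0; apply: edot_eq0; rewrite -sqr_enorm x0 expr0n. Qed.

(** Cauchy-Schwarz: expand the squared norm of [enorm y *: x - enorm x *: y] and divide by
    [enorm x * enorm y], whence the separate null cases. *)
Lemma edot_le_enorm x y : edot x y <= enorm x * enorm y.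
Proof.
have [/enorm0_eq0 ->|x0] := eqVneq (enorm x) 0.
  by rewrite /edot big1 ?mulr_ge0 ?enorm_ge0 // => i _; rewrite mxE mul0r.
have [/enorm0_eq0 ->|y0] := eqVneq (enorm y) 0.
  by rewrite /edot big1 ?mulr_ge0 ?enorm_ge0 // => i _; rewrite mxE mulr0.
have xp : 0 < enorm x by rewrite lt_def x0 enorm_ge0.
have yp : 0 < enorm y by rewrite lt_def y0 enorm_ge0.
have := edot_ge0 (enorm y *: x - enorm x *: y).
rewrite !edotE (edotC y x) -!sqr_enorm => h.
by rewrite -(ler_pM2l (mulr_gt0 xp yp)); lra.
Qed.

Lemma enormD x y : enorm (x + y) <= enorm x + enorm y.
Proof.
rewrite -(@ler_pXn2r _ 2) ?nnegrE ?addr_ge0 ?enorm_ge0 //.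
rewrite sqrrD !sqr_enorm !edotE (edotC y x).
by have := edot_le_enorm x y; lra.
Qed.

Lemma enormZ a x : enorm (a *: x) = `|a| * enorm x.
Proof.
by rewrite !enormE !edotE mulrA -expr2 sqrtrM ?sqr_ge0 // sqrtr_sqr.
Qed.

Lemma enormN x : enorm (- x) = enorm x.
Proof. by rewrite -scaleN1r enormZ normrN1 mul1r. Qed.

Lemma enormBC x y : enorm (x - y) = enorm (y - x).
Proof. by rewrite -enormN opprB. Qed.

Lemma norm_coord_le_enorm x (i : 'I_n) : `|x 0 i| <= enorm x.
Proof.
rewrite -sqrtr_sqr; apply: ler_wsqrtr; rewrite (bigD1 i) //= lerDl.
by apply: sumr_ge0 => j _; exact: sqr_ge0.
Qed.

Lemma enorm_le_coord x a : 0 <= a -> (forall i, `|x 0 i| <= a) ->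
  enorm x <= Num.sqrt n%:R * a.
Proof.
move=> a0 xa; rewrite -[X in _ * X](ger0_norm a0) -sqrtr_sqr -sqrtrM //.
apply: ler_wsqrtr; rewrite -[X in X%:R](card_ord n) -sum1_card natr_sum.
rewrite big_distrl /=; apply: ler_sum => i _.
by rewrite mul1r -[leLHS]real_normK ?num_real // lerXn2r ?nnegrE.
Qed.

(** The ambient topology is that of the sup norm, so continuity is checked through the coordinates.
    Closedness, hence measurability, of Euclidean balls rests on it. *)
Lemma continuous_enormB z : continuous (fun x => enorm (x - z)).
Proof.
move=> x; apply: (@continuous_comp _ _ _
  (fun x => \sum_(i < n) (x - z) 0 i ^+ 2) Num.sqrt); last first.
  exact: sqrt_continuous.
move: x; apply: continuous_big => [|i _ x]; first exact: add_continuous.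
apply: (@continuous_comp _ _ _ (fun x : 'rV_n => (x - z) 0 i)
  (fun a => a ^+ 2)); last exact: exprn_continuous.
have -> : (fun x : 'rV_n => (x - z) 0 i) = (fun x => x 0 i - z 0 i).
  by apply/funext => y; rewrite !mxE.
apply: continuousB; last exact: cst_continuous.
exact: (@coord_continuous R 1 n 0 i).
Qed.

Lemma closed_eball z r : closed (eball z r).
Proof.
apply: (@closed_comp _ _ (fun x => enorm (x - z)) [set a | a <= r]).
  by move=> x _; exact: continuous_enormB.
exact: closed_le.
Qed.

Lemma open_enorm_lt z r : open [set x | enorm (x - z) < r].
Proof.
apply: (@open_comp _ _ (fun x => enorm (x - z)) [set a | a < r]).
  by move=> x _; exact: continuous_enormB.
exact: open_lt.
Qed.

End Euclidean.

(** * Shape and mutual position of horoballs *)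

Section Horoballs.
Context {R : realType} {d : nat}.
Implicit Types (x y c p q : 'rV[R]_d.+1) (r a b : R) (B : set 'rV[R]_d.+1).

Lemma exists_unit_vector : exists x, enorm x = 1.
Proof.
exists (delta_mx 0 0); rewrite /enorm (bigD1 ord0) //= big1.
  by rewrite mxE eqxx addr0 expr1n sqrtr1.
by move=> i /negPf i0; rewrite mxE i0 expr0n.
Qed.

Lemma exists_unit_direction x : exists2 u, enorm u = 1 & x = enorm x *: u.
Proof.
have [x0|x0] := eqVneq (enorm x) 0.
  have [u u1] := exists_unit_vector.
  by exists u => //; rewrite x0 scale0r; exact: enorm0_eq0.
exists ((enorm x)^-1 *: x); last by rewrite scalerA divff // scale1r.
by rewrite enormZ ger0_norm ?invr_ge0 ?enorm_ge0 // mulVf.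
Qed.

Lemma ediam_eball c r : 0 <= r -> ediam (eball c r) = 2 * r.
Proof.
move=> r0; have [u u1] := exists_unit_vector.
apply/eqP; rewrite eq_le; apply/andP; split.
  apply: ge_sup.
    exists (enorm (c - c)); exists c; rewrite /eball /= ?subrr;
      last (exists c; rewrite /eball /= ?subrr //);
      by rewrite -(scale0r c) enormZ normr0 mul0r.
  move=> _ [x xB [y yB <-]]; have -> : x - y = (x - c) + (c - y).
    by rewrite addrA subrK.
  apply: le_trans (enormD _ _) _; rewrite (enormBC c).
  by move: xB yB; rewrite /eball /=; lra.
apply: ub_le_sup.
  exists (2 * r) => _ [x xB [y yB <-]]; have -> : x - y = (x - c) + (c - y).
    by rewrite addrA subrK.
  apply: le_trans (enormD _ _) _; rewrite (enormBC c).
  by move: xB yB; rewrite /eball /=; lra.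
exists (c + r *: u); first by rewrite /eball /= addrC addKr enormZ u1 mulr1 ger0_norm.
exists (c - r *: u).
  by rewrite /eball /= addrC addKr enormN enormZ u1 mulr1 ger0_norm.
rewrite opprB addrC subrKA -scalerDl enormZ u1 ger0_norm; lra.
Qed.

(** The interior condition gives [enorm c + r <= 1], and the triangle inequality at [p] forces
    equality. The inner product of [p] and [c] is then [1 - r], so [c - (1 - r) *: p] has norm
    zero. *)
Lemma horoball_eball p B : horoball p B ->
  exists r, [/\ 0 < r <= 1, enorm p = 1 & B = eball ((1 - r) *: p) r].
Proof.
move=> [[c [r r0 ->]] subD tang].
have [pB p1] : (eball c r `&` sphere) p by rewrite tang.
rewrite /sphere /= in p1; rewrite /eball /= in pB.
have [u u1 cu] := exists_unit_direction c.
(* Otherwise [c + t *: u], with t slightly less than r, escapes from the disc. *)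
have cr : enorm c + r <= 1.
  rewrite leNgt; apply/negP => cr.
  pose t := Num.max 0 (1 - enorm c).
  have tr : 0 <= t < r by rewrite le_max lexx /= gt_max r0; lra.
  have t1 : 1 - enorm c <= t by rewrite le_max lexx orbT.
  have /subD : (eball c r)° (c + t *: u).
    have sub : [set x | enorm (x - c) < r] `<=` eball c r by move=> x /ltW.
    apply: (interiorS sub); rewrite (interior_id _).1; last first.
      exact: open_enorm_lt.
    rewrite /=.
    by rewrite addrC addKr enormZ u1 mulr1 ger0_norm; lra.
  rewrite /disc /= {1}cu -scalerDl enormZ u1 mulr1 ger0_norm; last first.
    by have := enorm_ge0 c; lra.
  lra.
have tri : 1 <= enorm c + enorm (p - c).
  by rewrite -p1 -{1}(subrK c p) addrC; exact: enormD.
have pc : enorm (p - c) = r by lra.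
have c1 : enorm c = 1 - r by lra.
exists r; split => //; first by have := enorm_ge0 c; lra.
congr eball; apply/eqP; rewrite -subr_eq0; apply/eqP; apply: edot_eq0.
have := sqr_enorm p; have := sqr_enorm c; have := sqr_enorm (p - c).
rewrite pc c1 p1 !edotE (edotC c p) => e1 e2 e3.
have -> : edot p c = 1 - r by lra.
by rewrite -e2 -e3; lra.
Qed.

Lemma ediam_horoball_gt0 p B : horoball p B -> 0 < ediam B.
Proof.
move=> /horoball_eball[r [/andP[r0 _] _ ->]].
by rewrite ediam_eball ?mulr_gt0 // ltW.
Qed.

Lemma horoball_sphere p B : horoball p B -> enorm p = 1.
Proof. by move=> /horoball_eball[r []]. Qed.

(** The centre is at distance [1 - r] from the origin, so missing the origin means [r < 1 - r]. *)
Lemma ediam_horoball_lt1 p B : horoball p B -> ~ B 0 -> ediam B < 1.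
Proof.
move=> /horoball_eball[r [/andP[r0 r1] p1 ->]].
rewrite ediam_eball ?(ltW r0) // /eball /= sub0r enormN enormZ p1 mulr1.
rewrite ger0_norm; last by lra.
by move=> /negP; rewrite -ltNge; lra.
Qed.

(** Otherwise the point dividing the segment from [c1] to [c2] in the ratio [a : b] lies in both
    balls. *)
Lemma eball_disjoint_centers c1 c2 a b : 0 < a -> 0 < b ->
  eball c1 a `&` eball c2 b = set0 -> a + b < enorm (c1 - c2).
Proof.
move=> a0 b0; rewrite ltNge => dis; apply/negP => le_ab.
suff : set0 (c1 + (a / (a + b)) *: (c2 - c1)) by [].
have ab : 0 < a + b by lra.
rewrite -dis; split; rewrite /eball /=.
  rewrite addrC addKr enormZ enormBC ger0_norm; last by rewrite divr_ge0 ?ltW.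
  by rewrite mulrAC ler_pdivrMr // ler_pM2l.
have -> : c1 + (a / (a + b)) *: (c2 - c1) - c2 = (b / (a + b)) *: (c1 - c2).
  have -> : b / (a + b) = 1 - a / (a + b) by field; lra.
  by apply/rowP => i; rewrite !mxE; ring.
rewrite enormZ ger0_norm; last by rewrite divr_ge0 ?ltW.
by rewrite mulrAC ler_pdivrMr // ler_pM2l.
Qed.

(** For radii [a] and [b], the squared distance of the centres is
    [(a - b)^2 + (1 - a)(1 - b)|p - q|^2]. Disjointness makes it exceed [(a + b)^2], so [4ab], the
    product of the diameters, is at most [(1 - a)(1 - b)|p - q|^2]. *)
Lemma horoball_separation p q B1 B2 : horoball p B1 -> horoball q B2 ->
  B1 `&` B2 = set0 -> ediam B1 * ediam B2 <= enorm (p - q) ^+ 2.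
Proof.
move=> /horoball_eball[a [/andP[a0 a1] p1 ->]].
move=> /horoball_eball[b [/andP[b0 b1] q1 ->]].
move=> /(eball_disjoint_centers a0 b0) sep.
rewrite !ediam_eball ?(ltW a0) ?(ltW b0) //.
have : (a + b) ^+ 2 <= enorm ((1 - a) *: p - (1 - b) *: q) ^+ 2.
  by rewrite lerXn2r ?nnegrE ?enorm_ge0 ?addr_ge0 ?ltW.
have := sqr_enorm p; have := sqr_enorm q.
have pq0 := edot_ge0 (p - q); move: pq0.
rewrite p1 q1 !sqr_enorm !edotE (edotC q p) => pq0 e1 e2.
rewrite -e1 -e2 in pq0 *; set t := edot p q in pq0 *.
(* Here [2 - 2 * t] is [|p - q|^2], and the first factor is [1 - (1 - a)(1 - b)]. *)
have : 0 <= (a + b - a * b) * (2 - 2 * t).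
  apply: mulr_ge0; last by lra.
  have : a * b <= a * 1 by rewrite ler_pM2l.
  lra.
by lra.
Qed.

End Horoballs.

(** * Packing of separated points *)

Section Packing.
Context {R : realType}.

Lemma card_le_finType (T : choiceType) (F : finType) (f : T -> F) (X : set T) :
  {in X &, injective f} -> X #<= `I_#|F|.
Proof.
move=> f_inj; pose g x := nat_of_ord (enum_rank (f x)).
have g_inj : {in X &, injective g}.
  by move=> x y xX yX /ord_inj/enum_rank_inj; exact: f_inj.
rewrite -(card_le_eql (inj_card_eq g_inj)).
by apply: subset_card_le => _ [x _ <-]; exact: ltn_ord.
Qed.

Lemma same_truncn (x y : R) : 0 <= x -> 0 <= y -> Num.truncn x = Num.truncn y ->
  `|x - y| <= 1.
Proof.
move=> /truncn_itv/andP[] + + /truncn_itv/andP[] + + e.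
rewrite e -addn1 natrD ler_distlC => h1 h2 h3 h4.
by apply/andP; split; lra.
Qed.

(** Pigeonhole on a grid: [u] rescales each coordinate to [[0, 2K]], whose integer parts take
    [2K + 1] values. Points with equal integer parts differ by at most [r / K] in each coordinate,
    hence by less than [a * r] in norm. *)
Lemma eball_packing (d : nat) (a : R) : 0 < a ->
  exists N : nat, forall (z : 'rV[R]_d) (r : R) (X : set 'rV[R]_d),
    0 < r -> X `<=` eball z r ->
    (forall p q, X p -> X q -> p <> q -> a * r <= enorm (p - q)) ->
    X #<= `I_N.
Proof.
move=> a0; pose K := (Num.truncn (Num.sqrt d%:R / a)).+1.
have K0 : (0 : R) < K%:R by rewrite ltr0n.
have Ka : Num.sqrt d%:R < a * K%:R.
  by rewrite mulrC -ltr_pdivrMr //; exact: truncnS_gt.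
exists #|{ffun 'I_d -> 'I_(2 * K).+1}| => z r X r0 Xz sep.
pose u (x : 'rV[R]_d) i := (x 0 i - z 0 i + r) / r * K%:R.
pose f (x : 'rV[R]_d) : {ffun 'I_d -> 'I_(2 * K).+1} :=
  [ffun i => inord (Num.truncn (u x i))].
have u_itv x i : X x -> 0 <= u x i <= (2 * K)%:R.
  move=> /Xz xz; have := norm_coord_le_enorm (x - z) i.
  rewrite !mxE => /le_trans/(_ xz); rewrite ler_norml => /andP[h1 h2].
  rewrite /u natrM mulr_ge0 ?divr_ge0 ?ler0n ?(ltW r0) //=; last by lra.
  by rewrite ler_pM2r // ler_pdivrMr //; lra.
apply: (@card_le_finType _ _ f) => p q /set_mem Xp /set_mem Xq fpq.
apply: contrapT => pq; have := sep _ _ Xp Xq pq; apply/negP; rewrite -ltNge.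
apply: (@le_lt_trans _ _ (Num.sqrt d%:R * (r / K%:R))).
  apply: enorm_le_coord => [|i]; first by rewrite divr_ge0 ?ltW.
  have /andP[p0 p1] := u_itv p i Xp; have /andP[q0 q1] := u_itv q i Xq.
  have : `|u p i - u q i| <= 1.
    apply: same_truncn => //.
    have := congr1 (fun g : {ffun 'I_d -> 'I_(2 * K).+1} => val (g i)) fpq.
    rewrite !ffunE /= !inordK //.
      by rewrite ltnS -(ler_nat R) (le_trans _ q1) // truncn_le.
    by rewrite ltnS -(ler_nat R) (le_trans _ p1) // truncn_le.
  have -> : u p i - u q i = (p - q) 0 i * (K%:R / r).
    by rewrite !mxE /u; field; rewrite gt_eqF.
  have Kr : 0 < K%:R / r by rewrite divr_gt0.
  rewrite normrM (gtr0_norm Kr).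
  by rewrite -ler_pdivlMr // invf_div mul1r.
by rewrite mulrA ltr_pdivrMr // mulrAC ltr_pM2r.
Qed.

End Packing.

(** * Series in the extended reals *)

Section Ereal_sums.
Context {R : realType}.
Local Open Scope ereal_scope.

Lemma esumZl (D : set nat) (f : nat -> \bar R) (c : R) : (0 <= c)%R ->
  (forall k, D k -> 0 <= f k) ->
  \esum_(k in D) (c%:E * f k) = c%:E * \esum_(k in D) f k.
Proof.
move=> c0 f0.
have f0' k : k \in D -> 0 <= f k by move=> /set_mem; exact: f0.
have <- : [set k | k \in D] = D by exact: set_mem_set.
rewrite -!nneseries_esum //; last by move=> k kD; rewrite mule_ge0 ?f0'.
exact: nneseriesZl.
Qed.

Lemma esum_le_partial_sums (D : set nat) (f : nat -> \bar R) (M : \bar R) :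
  (forall k, D k -> 0 <= f k) ->
  (forall n, \sum_(0 <= k < n | k \in D) f k <= M) ->
  \esum_(k in D) f k <= M.
Proof.
move=> f0 fM.
have f0' k : k \in D -> 0 <= f k by move=> /set_mem; exact: f0.
have <- : [set k | k \in D] = D by exact: set_mem_set.
rewrite -nneseries_esum //.
apply: lime_le; last exact: nearW.
by apply: is_cvg_nneseries_cond => n _; exact: f0'.
Qed.

(** Gaps in [D] only decrease the sum, and multiplying a full partial sum by [1 - x] telescopes to
    [x ^+ k0 - x ^+ n]. *)
Lemma esum_geometric_le (D : set nat) (k0 : nat) (x : R) : (0 <= x < 1)%R ->
  (forall k, D k -> (k0 <= k)%N) ->
  \esum_(k in D) (x ^+ k)%:E <= (x ^+ k0 / (1 - x))%:E.
Proof.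
move=> /andP[x0 x1] Dk0.
apply: esum_le_partial_sums => [k _|n]; first by rewrite lee_fin exprn_ge0.
rewrite sumEFin lee_fin ler_pdivlMr ?subr_gt0 //.
apply: (@le_trans _ _ ((\sum_(0 <= k < n | (k0 <= k)%N) x ^+ k) * (1 - x))%R).
  rewrite ler_pM2r ?subr_gt0 // [leLHS]big_mkcond [leRHS]big_mkcond /=.
  apply: ler_sum => k _; case: ifPn => [/set_mem/Dk0 -> //|_].
  by case: ifP => // _; exact: exprn_ge0.
have [nk0|k0n] := leqP n k0.
  rewrite big_nat_cond big1 ?mul0r ?exprn_ge0 // => k /andP[/andP[_ kn] k0k].
  by have := leq_trans kn (leq_trans nk0 k0k); rewrite ltnn.
suff -> : ((\sum_(0 <= k < n | (k0 <= k)%N) x ^+ k) * (1 - x) = x ^+ k0 - x ^+ n)%R.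
  by rewrite gerBl exprn_ge0.
elim: n k0n => // n IHn; rewrite ltnS leq_eqVlt => /orP[/eqP k0n|k0n].
  rewrite big_mkcond big_nat_recr //= -big_mkcond /= -k0n leqnn.
  rewrite big_nat_cond big1 ?add0r.
    by rewrite exprSr mulrBr mulr1.
  by move=> k /andP[/andP[_ kn] k0k]; have := leq_trans kn k0k; rewrite ltnn.
rewrite big_mkcond big_nat_recr //= -big_mkcond /= (ltnW k0n) mulrDl IHn //.
by rewrite exprSr; ring.
Qed.

End Ereal_sums.

(** * Measuring finite sets through their atoms *)

Section Atoms.
Context {R : realType} {d : nat}.
Implicit Types (mu nu : probability (borel R d) R) (X : set 'rV[R]_d.+1).
Local Open Scope ereal_scope.

Lemma closed_measurable_borel X : closed X -> measurable (X : set (borel R d)).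
Proof.
move=> cX; rewrite -[X]setCK; apply: measurableC.
by apply: sub_sigma_algebra; rewrite /= openC.
Qed.

Lemma finite_measurable_borel X : finite_set X ->
  measurable (X : set (borel R d)).
Proof.
move=> fX; apply: closed_measurable_borel; move: X fX.
apply/accessible_finite_set_closed; apply: hausdorff_accessible.
exact: norm_hausdorff.
Qed.

Lemma measure_finite_set mu X : finite_set X ->
  mu X = \sum_(p <- fset_set X) mu [set p].
Proof.
move=> fX; rewrite -fsbig_finite // -measure_fin_bigcup //.
- by rewrite bigcup_imset1 image_id.
- by move=> p q _ _ [x [<- <-]].
- by move=> p _; apply: finite_measurable_borel; exact: finite_set1.
Qed.

Lemma sum_cst_counting X (a : R) : finite_set X ->
  \sum_(p <- fset_set X) a%:E = a%:E * counting X.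
Proof.
move=> fX; rewrite sumEFin /counting asboolT //.
by rewrite big_const_seq count_predT iter_addr_0 -EFinM mulr_natr.
Qed.

Lemma measure_finite_le_counting mu X (a : R) : finite_set X ->
  (forall p, X p -> mu [set p] <= a%:E) -> mu X <= a%:E * counting X.
Proof.
move=> fX Xa; rewrite measure_finite_set // -sum_cst_counting //.
rewrite [leLHS]big_seq [leRHS]big_seq; apply: lee_sum => p.
by rewrite in_fset_set // => /set_mem/Xa.
Qed.

Lemma counting_le_measure_finite mu X (a : R) : finite_set X ->
  (forall p, X p -> a%:E <= mu [set p]) -> a%:E * counting X <= mu X.
Proof.
move=> fX Xa; rewrite measure_finite_set // -sum_cst_counting //.
rewrite [leLHS]big_seq [leRHS]big_seq; apply: lee_sum => p.
by rewrite in_fset_set // => /set_mem/Xa.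
Qed.

Lemma measure_finite_le_measure mu nu X (a : R) : (0 <= a)%R -> finite_set X ->
  (forall p, X p -> mu [set p] <= a%:E * nu [set p]) -> mu X <= a%:E * nu X.
Proof.
move=> a0 fX Xa; rewrite !measure_finite_set // ge0_sume_distrr //.
rewrite [leLHS]big_seq [leRHS]big_seq; apply: lee_sum => p.
by rewrite in_fset_set // => /set_mem/Xa.
Qed.

End Atoms.

(** * Locating a number between consecutive powers *)

Section Powers.
Context {R : realType}.
Implicit Types t e : R.

Lemma exists_expr_lt t e : 0 < t < 1 -> 0 < e -> exists n : nat, t ^+ n < e.
Proof.
move=> /andP[t0 t1] e0.
have /cvgrPdist_lt/(_ _ e0) : GRing.exp t @ \oo --> (0 : R).
  by apply: cvg_expr; rewrite gtr0_norm.
move=> [n _ /(_ n (leqnn n))] /=.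
by rewrite sub0r normrN gtr0_norm ?exprn_gt0 //; exists n.
Qed.

(** [n.+1] is the least exponent whose power is at most [e], nonzero because [e < 1]. The position
    of the strict inequality matches the shells. *)
Lemma expr_bracket_ge t e : 0 < t < 1 -> 0 < e < 1 ->
  exists n : nat, t ^+ n.+1 <= e < t ^+ n.
Proof.
move=> t01 /andP[e0 e1].
have [|n tn nmin] := @ex_minnP (fun n => t ^+ n <= e).
  by have [n tn] := exists_expr_lt t01 e0; exists n; exact: ltW.
case: n tn nmin => [|n tn nmin]; first by rewrite expr0 leNgt e1.
exists n; rewrite tn ltNge; apply/negP => /nmin.
by rewrite ltnn.
Qed.

(** Here the lower inequality is the strict one, to match cut-offs such as [tau ^+ k < r]. *)
Lemma expr_bracket_gt t e : 0 < t < 1 -> 0 < e <= 1 ->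
  exists n : nat, t ^+ n.+1 < e <= t ^+ n.
Proof.
move=> t01 /andP[e0 e1].
have [|n tn nmin] := @ex_minnP (fun n => t ^+ n < e).
  exact: exists_expr_lt.
case: n tn nmin => [|n tn nmin]; first by rewrite expr0 ltNge e1.
exists n; rewrite tn leNgt; apply/negP => /nmin.
by rewrite ltnn.
Qed.

Lemma ltr_expn2l_imp t i j : 0 < t < 1 -> t ^+ i < t ^+ j -> (j < i)%N.
Proof. by move=> /andP[t0 t1]; rewrite ltr_iXn2l. Qed.

End Powers.

(** * Decomposition of a ball into shells by horoball size *)

Section Shells.
Context {R : realType} {d : nat}.
Context (G : set ('rV[R]_d.+1 -> 'rV[R]_d.+1)) (H : 'rV[R]_d.+1 -> set 'rV[R]_d.+1).
Context (hH : standard_horoballs G H).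
Implicit Types (z p q : 'rV[R]_d.+1) (r e tau : R) (k : nat).
Local Notation P := (parabolic_points G).

Lemma diam_itv p : P p -> 0 < ediam (H p) < 1.
Proof.
case: hH => hor _ H0 _ Pp; have hp := hor _ Pp.
by rewrite (ediam_horoball_gt0 hp) (ediam_horoball_lt1 hp) //; exact: H0.
Qed.

Lemma parabolic_separation p q e : 0 < e -> P p -> P q -> p <> q ->
  e <= ediam (H p) -> e <= ediam (H q) -> e <= enorm (p - q).
Proof.
case: hH => hor dis _ _ e0 Pp Pq pq ep eq.
have := horoball_separation (hor _ Pp) (hor _ Pq) (dis _ _ Pp Pq pq).
move=> /(le_trans (ler_pM (ltW e0) (ltW e0) ep eq)); rewrite -expr2.
by rewrite ler_pXn2r ?nnegrE ?enorm_ge0 ?(ltW e0).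
Qed.

Lemma finite_parabolic_ge z r e : 0 < r -> 0 < e ->
  finite_set [set p | [/\ P p, eball z r p & e <= ediam (H p)]].
Proof.
move=> r0 e0; have [N packN] := @eball_packing R d.+1 _ (divr_gt0 e0 r0).
apply/finite_set_leP; exists N; apply: (packN z r) => //.
  by move=> p [].
move=> p q [Pp _ ep] [Pq _ eq] pq; rewrite divfK ?gt_eqF //.
exact: parabolic_separation.
Qed.

(** Named so that it can be measured as well as counted: [horoball_count] is, by conversion,
    [counting] of this set. *)
Definition shell tau z r k : set 'rV[R]_d.+1 :=
  [set p | [/\ P p, eball z r p & tau ^+ k.+1 <= ediam (H p) < tau ^+ k]].

Lemma finite_shell tau z r k : 0 < tau -> 0 < r -> finite_set (shell tau z r k).
Proof.
move=> t0 r0; apply: (sub_finite_set _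
  (finite_parabolic_ge z r0 (exprn_gt0 k.+1 t0))).
by move=> p [Pp zp /andP[]].
Qed.

Lemma trivIset_shell tau z r D : 0 < tau < 1 -> trivIset D (shell tau z r).
Proof.
move=> t01 i j _ _ [p [[_ _ /andP[i1 i2]] [_ _ /andP[j1 j2]]]].
apply/eqP; rewrite eqn_leq.
have /(ltr_expn2l_imp t01) := le_lt_trans i1 j2; rewrite ltnS => ->.
by have /(ltr_expn2l_imp t01) := le_lt_trans j1 i2; rewrite ltnS => ->.
Qed.

(** The first power of [tau] below [r] is at least [tau * r]. *)
Lemma large_points_ge tau z r p : 0 < tau < 1 -> 0 < r <= 1 ->
  large_points G H tau z r p -> tau * r <= ediam (H p).
Proof.
move=> t01 r01 [_ _ large].
have [n /andP[n1 n2]] := expr_bracket_gt t01 r01.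
have /andP[t0 _] := t01.
apply: (le_trans _ (large n.+1%:Z n1)).
by rewrite -exprnP exprS ler_pM2l.
Qed.

Lemma card_large_points tau : 0 < tau < 1 -> exists N : nat,
  forall z r, 0 < r <= 1 -> large_points G H tau z r #<= `I_N.
Proof.
move=> t01; have /andP[t0 _] := t01.
have [N packN] := @eball_packing R d.+1 _ t0; exists N => z r r01.
have /andP[r0 _] := r01.
apply: (packN z r) => //; first by move=> p [].
move=> p q Lp Lq pq; have [Pp _ _] := Lp; have [Pq _ _] := Lq.
by apply: parabolic_separation => //; [exact: mulr_gt0|
  exact: large_points_ge Lp|exact: large_points_ge Lq].
Qed.

(** A point of shell [n] belongs to the union if [tau ^+ n < r]. Otherwise every [k] with
    [tau ^ k < r] exceeds [n], so the point is large. *)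
Lemma eball_parabolicE tau z r : 0 < tau < 1 -> 0 < r <= 1 ->
  eball z r `&` P = large_points G H tau z r `|`
    \bigcup_(k in [set k | tau ^+ k < r]) shell tau z r k.
Proof.
move=> t01 r01; apply/seteqP; split=> [p [zp Pp]|p]; last first.
  by move=> [[]//|[k _ []]].
have [n /andP[n1 n2]] := expr_bracket_ge t01 (diam_itv Pp).
have [rn|nr] := leP r (tau ^+ n); last by right; exists n => //; split=> //; apply/andP.
left; split=> // j jr; apply: le_trans n1.
have /andP[t0 t1] := t01.
case: j jr => [j|j] jr.
  rewrite -exprnP ler_iXn2l //; have := lt_le_trans jr rn.
  exact: (ltr_expn2l_imp t01).
(* A negative exponent gives a power of at least 1, which cannot be below [r <= 1]. *)
have /andP[_ r1] := r01; have := lt_le_trans jr r1; rewrite NegzE -exprnN.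
by rewrite ltNge invf_ge1 ?exprn_gt0 // exprn_ile1 // ltW.
Qed.

Lemma large_shell_disjoint tau z r k : tau ^+ k < r ->
  large_points G H tau z r `&` shell tau z r k = set0.
Proof.
move=> kr; apply/seteqP; split=> // p [[_ _ /(_ k%:Z kr)] large [_ _]].
by rewrite -exprnP in large; rewrite ltNge large andbF.
Qed.

(** The closed unit ball about the origin contains the sphere, so no parabolic point is lost. This
    exhibits [P] as a countable union of finite sets, hence measurable. *)
Lemma parabolicE tau : 0 < tau < 1 -> P = \bigcup_k shell tau 0 1 k.
Proof.
move=> t01; apply/seteqP; split=> [p Pp|p [k _ []]//].
have [n n12] := expr_bracket_ge t01 (diam_itv Pp); exists n => //; split=> //.
case: hH => hor _ _ _.
by rewrite /eball /= subr0 (horoball_sphere (hor _ Pp)).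
Qed.

Local Open Scope ereal_scope.

Lemma measurable_shell tau z r k : (0 < tau)%R -> (0 < r)%R ->
  measurable (shell tau z r k : set (borel R d)).
Proof. by move=> t0 r0; apply: finite_measurable_borel; exact: finite_shell. Qed.

Lemma measurable_parabolic : measurable (P : set (borel R d)).
Proof.
have t01 : (0 < 2^-1 :> R)%R && (2^-1 < 1 :> R)%R by apply/andP; split; lra.
rewrite (parabolicE t01); apply: bigcup_measurable => k _.
by apply: measurable_shell => //; lra.
Qed.

Lemma measure_eball_shells tau z r (mu : probability (borel R d) R) :
  (0 < tau < 1)%R -> (0 < r <= 1)%R -> mu (~` P) = 0 ->
  mu (eball z r) = mu (large_points G H tau z r) +
    \esum_(k in [set k | (tau ^+ k < r)%R]) mu (shell tau z r k).
Proof.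
move=> t01 r01 muP; have /andP[t0 _] := t01; have /andP[r0 _] := r01.
have mB : measurable (eball z r : set (borel R d)).
  by apply: closed_measurable_borel; exact: closed_eball.
have mP := measurable_parabolic.
have mS k : [set k | (tau ^+ k < r)%R] k ->
    measurable (shell tau z r k : set (borel R d)).
  by move=> _; exact: measurable_shell.
have finL : finite_set (large_points G H tau z r).
  have [N largeN] := card_large_points t01.
  by apply/finite_set_leP; exists N; exact: largeN.
transitivity (mu (eball z r `&` P)).
  rewrite [LHS](measureDI _ mB mP) // [X in X + _](_ : _ = 0) ?add0e //.
  apply/eqP; rewrite eq_le measure_ge0 andbT -muP.
  apply: le_measure; last exact: subIsetr.
    by apply/mem_set; exact: measurableD.
  by apply/mem_set; exact: measurableC.
rewrite (eball_parabolicE _ t01 r01) measureU //.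
- congr (_ + _); rewrite -[X in esum X]set_mem_set -nneseries_esum //.
  by apply: measure_bigcup => //; exact: trivIset_shell.
- exact: finite_measurable_borel.
- exact: bigcup_measurable.
- rewrite setI_bigcupr; apply/seteqP; split=> // p [k kr].
  by rewrite large_shell_disjoint.
Qed.

End Shells.

Lemma finite_set_argmax (R : realType) (T : choiceType) (X : set T)
    (f : T -> R) : finite_set X -> X !=set0 ->
  exists2 p, X p & forall q, X q -> f q <= f p.
Proof.
move=> /finite_seqP[s ->] {X}; elim: s => [[]//|a s IHs _].
case: s IHs => [_|b s IHs].
  by exists a; [rewrite /= inE|move=> q /=; rewrite inE => /eqP ->].
have [|p ps pmax] := IHs; first by exists b; rewrite /= mem_head.
have [fap|fpa] := leP (f a) (f p).
  exists p; first by rewrite /= inE ps orbT.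
  by move=> q /=; rewrite inE => /orP[/eqP ->//|/pmax].
exists a; first by rewrite /= mem_head.
move=> q /=; rewrite inE => /orP[/eqP ->//|/pmax qp].
exact: le_trans qp (ltW fpa).
Qed.

Lemma poincare_exponent_ge0 (R : realType) (d : nat)
    (G : set ('rV[R]_d.+1 -> 'rV[R]_d.+1)) : 0 <= poincare_exponent G.
Proof.
rewrite /poincare_exponent; set S := [set _ | _].
(* The infimum of the empty set is 0 by convention. *)
have [->|/set0P S0] := eqVneq S set0; first by rewrite inf0.
by apply: lb_le_inf => // s [/ltW].
Qed.

(** * Consequences of the comparability of atoms *)

Section Atom_estimates.
Context {R : realType} {d : nat}.
Context (G : set ('rV[R]_d.+1 -> 'rV[R]_d.+1)) (H : 'rV[R]_d.+1 -> set 'rV[R]_d.+1).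
Context (hH : standard_horoballs G H) (A0 tau : R) (hA0 : 1 <= A0)
  (htau : 0 < tau < 1).
Implicit Types (z p q : 'rV[R]_d.+1) (r e s : R) (k : nat)
  (mu nu : probability (borel R d) R).
Local Notation P := (parabolic_points G).

Let A0_gt0 : 0 < A0. Proof. exact: lt_le_trans hA0. Qed.
Let tau_gt0 : 0 < tau. Proof. by case/andP: htau. Qed.

Local Open Scope ereal_scope.

Lemma shell_measure_le s mu z r k : (0 <= s)%R -> (0 < r)%R ->
  atoms_comparable G H A0 s mu ->
  mu (shell G H tau z r k) <=
    A0%:E * (horoball_count G H tau z r k * (tau `^ (k%:R * s))%:E).
Proof.
move=> s0 r0 atoms; rewrite [X in _ * X]muleC muleA -EFinM.
apply: measure_finite_le_counting; first exact: finite_shell.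
move=> p [Pp _ /andP[_ pk]]; apply: le_trans (atoms p Pp).2 _.
rewrite lee_fin ler_pM2l // powRrM powR_mulrn ?(ltW tau_gt0) //.
have /andP[p0 _] := diam_itv hH Pp.
apply: ge0_ler_powR => //.
- by rewrite nnegrE ltW.
- by rewrite nnegrE exprn_ge0 // ltW.
- exact: ltW.
Qed.

(** The factor [tau^s] is lost because diameters in shell [k] may be as small as [tau ^+ k.+1]; an
    upper bound on [s] will make this loss uniform. *)
Lemma shell_measure_ge s mu z r k : (0 <= s)%R -> (0 < r)%R ->
  atoms_comparable G H A0 s mu ->
  (A0^-1 * tau `^ s)%:E *
    (horoball_count G H tau z r k * (tau `^ (k%:R * s))%:E)
  <= mu (shell G H tau z r k).
Proof.
move=> s0 r0 atoms; rewrite [X in _ * X]muleC muleA -EFinM.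
apply: counting_le_measure_finite; first exact: finite_shell.
move=> p [Pp _ /andP[pk _]]; apply: le_trans _ (atoms p Pp).1.
rewrite lee_fin -mulrA ler_pM2l ?invr_gt0 //.
rewrite powRrM powR_mulrn ?(ltW tau_gt0) // -powRM ?exprn_ge0 ?(ltW tau_gt0) //.
have /andP[p0 _] := diam_itv hH Pp.
rewrite -exprS; apply: ge0_ler_powR => //.
- by rewrite nnegrE exprn_ge0 // ltW.
- by rewrite nnegrE ltW.
Qed.

Lemma large_measure_bounds : exists2 N : R, (0 < N)%R &
  forall s mu z r, (0 <= s)%R -> (0 < r <= 1)%R ->
    atoms_comparable G H A0 s mu ->
    (A0^-1)%:E * (large_term G H tau s z r)%:E
      <= mu (large_points G H tau z r) /\
    mu (large_points G H tau z r)
      <= (N * A0)%:E * (large_term G H tau s z r)%:E.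
Proof.
have [N cardL] := card_large_points hH htau.
(* The successor only serves to keep the constant positive. *)
exists N.+1%:R => // s mu z r s0 r01 atoms; have LN := cardL z r r01.
have finL : finite_set (large_points G H tau z r).
  by apply/finite_set_leP; exists N.
have [L0|/set0P L0] := eqVneq (large_points G H tau z r) set0.
  (* Without large points [xget] returns its default 0, and both bounds read [0 <= 0]. *)
  rewrite L0 measure0 /large_term xgetPN ?mule0 //.
  by move=> x [p [+ _] _]; rewrite L0.
have [p' Lp' maxp'] := finite_set_argmax (fun p => ediam (H p)) finL L0.
have -> : large_term G H tau s z r = (ediam (H p') `^ s)%R.
  apply: xget_unique; first by exists p'.
  move=> _ [q [Lq maxq] <-]; congr powR; apply: le_anti.
  by rewrite maxp' // maxq.
have [Pp' _ _] := Lp'; split.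
  rewrite -EFinM; apply: le_trans (atoms p' Pp').1 _.
  apply: le_measure; last by move=> x ->.
    by apply/mem_set; apply: finite_measurable_borel; exact: finite_set1.
  by apply/mem_set; exact: finite_measurable_borel.
apply: (@le_trans _ _ ((A0 * ediam (H p') `^ s)%:E *
    counting (large_points G H tau z r))).
  apply: measure_finite_le_counting => // p Lp; have [Pp _ _] := Lp.
  apply: le_trans (atoms p Pp).2 _; rewrite lee_fin ler_pM2l //.
  have /andP[p0 _] := diam_itv hH Pp; have /andP[p'0 _] := diam_itv hH Pp'.
  by apply: ge0_ler_powR; rewrite ?nnegrE ?(ltW p0) ?(ltW p'0) ?maxp'.
rewrite /counting asboolT // -!EFinM lee_fin mulrC -mulrA.
rewrite ler_wpM2r ?mulr_ge0 ?powR_ge0 ?(ltW A0_gt0) // ler_nat.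
by apply: leqW; exact: geq_card_fset_set.
Qed.

(** Only finitely many horoballs have diameter at least 1/2, and each diameter is below 1, so the
    largest of these is a uniform bound below 1. *)
Lemma exists_diam_bound : exists2 m : R, (0 < m < 1)%R &
  forall p, P p -> (ediam (H p) <= m)%R.
Proof.
have fin := finite_parabolic_ge hH 0 (@ltr01 R) (ltac:(lra) : (0 < 2^-1 :> R)%R).
set X := [set p | _] in fin.
have XP p : P p -> (2^-1 <= ediam (H p))%R -> X p.
  move=> Pp hp; split=> //; case: hH => hor _ _ _.
  by rewrite /eball /= subr0 (horoball_sphere (hor _ Pp)).
have [X0|/set0P X0] := eqVneq X set0.
  exists 2^-1%R; first by apply/andP; split; lra.
  move=> p Pp; rewrite leNgt; apply/negP => /ltW /(XP _ Pp).
  by rewrite X0.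
have [p' [Pp' _ p'2] maxp'] := finite_set_argmax (fun p => ediam (H p)) fin X0.
exists (ediam (H p')); first by move: (diam_itv hH Pp').
move=> p Pp; have [p2|/ltW p2] := leP 2^-1%R (ediam (H p)).
  by apply: maxp'; exact: XP.
exact: le_trans p'2.
Qed.

(** Both measures have total mass 1 carried by [P], so summing the comparison of atoms over all
    shells compares 1 with [a]. *)
Lemma measure_le_of_atoms mu nu (a : R) : (0 <= a)%R ->
  mu (~` P) = 0 -> nu (~` P) = 0 ->
  (forall p, P p -> mu [set p] <= a%:E * nu [set p]) -> 1 <= a%:E.
Proof.
move=> a0 mu0 nu0 le_atoms.
have mP := measurable_parabolic hH.
have full (la : probability (borel R d) R) : la (~` P) = 0 ->
    \sum_(k <oo) la (shell G H tau 0 1 k) = 1.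
  move=> la0; transitivity (la P).
    rewrite [in RHS](parabolicE hH htau); apply/esym/measure_semi_bigcup.
    - by move=> k; exact: measurable_shell.
    - exact: trivIset_shell.
    - by rewrite -(parabolicE hH htau).
  rewrite -[P]setCK probability_setC ?la0 ?sube0 //.
  exact: measurableC.
rewrite -[leRHS]mule1 -{1}(full mu mu0) -(full nu nu0) -nneseriesZl //.
apply: lee_nneseries => // k _.
apply: measure_finite_le_measure => //; first exact: finite_shell.
by move=> p [Pp _ _]; exact: le_atoms.
Qed.

Lemma exponent_upper_bound : exists s1 : R, forall s mu,
  mu (~` P) = 0 -> atoms_comparable G H A0 s mu -> (s <= s1)%R.
Proof.
(* Any one pair of exponent and measure serves as the reference for all others; if there is none,
   there is nothing to bound. *)
have [[s0 [mu0 [mu00 atoms0]]]|none] := pselect (exists s0 mu0,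
    mu0 (~` P) = 0 /\ atoms_comparable G H A0 s0 mu0); last first.
  by exists 0%R => s mu mu0 atoms; case: none; exists s, mu.
have [m /[dup] m01 /andP[m0 m1] diam_m] := exists_diam_bound.
have A2 : (0 < (A0 * A0)^-1)%R by rewrite invr_gt0 mulr_gt0.
(* This makes [A0 * A0 * m ^+ n < 1], which an exponent above [s0 + n] would contradict. *)
have [n mn] := exists_expr_lt m01 A2.
exists (s0 + n%:R)%R => s mu muP atoms; rewrite leNgt; apply/negP => sn.
suff : 1 <= (A0 * A0 * m ^+ n)%:E.
  by rewrite lee_fin leNgt mulrC -ltr_pdivlMr ?mulr_gt0 // mul1r mn.
apply: (measure_le_of_atoms _ muP mu00).
  by rewrite !mulr_ge0 ?exprn_ge0 ?(ltW A0_gt0) ?(ltW m0).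
move=> p Pp; apply: le_trans (atoms p Pp).2 _.
have /andP[p0 p1] := diam_itv hH Pp.
apply: (@le_trans _ _ ((A0 * A0 * m ^+ n)%:E * (A0^-1 * ediam (H p) `^ s0)%:E));
  last first.
  apply: lee_wpmul2l (atoms0 p Pp).1; rewrite lee_fin.
  by rewrite !mulr_ge0 ?exprn_ge0 ?(ltW A0_gt0) ?(ltW m0).
rewrite -EFinM lee_fin.
have -> : (A0 * A0 * m ^+ n * (A0^-1 * ediam (H p) `^ s0) =
   A0 * (ediam (H p) `^ s0 * m ^+ n))%R by field; rewrite gt_eqF.
rewrite ler_pM2l // -{1}(subrKC s0 s) powRD ?(gt_eqF p0) ?implybT //.
rewrite ler_pM2l ?powR_gt0 //.
apply: (@le_trans _ _ (ediam (H p) `^ n%:R)%R).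
  by apply: ger_powR; rewrite ?p0 ?(ltW p1) //; lra.
rewrite powR_mulrn ?(ltW p0) //.
by rewrite lerXn2r ?nnegrE ?(ltW p0) ?(ltW m0) ?diam_m.
Qed.

End Atom_estimates.

(** Bernoulli's inequality, which keeps [x ^+ M] above one half in [ratio_bound]. *)
Lemma bernoulli_le (R : realType) (a : R) (n : nat) : 0 <= a <= 1 ->
  1 - n%:R * a <= (1 - a) ^+ n.
Proof.
move=> /andP[a0 a1]; elim: n => [|n IHn]; first by rewrite expr0; lra.
rewrite exprS; apply: (@le_trans _ _ ((1 - a) * (1 - n%:R * a))); last first.
  by rewrite ler_wpM2l // subr_ge0.
have : 0 <= n%:R * a * a by rewrite !mulr_ge0.
by rewrite -natr1; lra.
Qed.

Lemma counting_ge0 (R : realType) (T : choiceType) (X : set T) :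
  (0 <= counting X :> \bar R)%E.
Proof. by rewrite /counting; case: ifP => _; rewrite ?lee_fin ?leey. Qed.

Lemma probability_eball_fin (R : realType) (d : nat)
    (mu : probability (borel R d) R) (z : 'rV[R]_d.+1) (r : R) :
  exists2 m, 0 <= m & mu (eball z r) = m%:E.
Proof.
have fin : mu (eball z r) \is a fin_num.
  by apply: fin_num_measure; apply: closed_measurable_borel; exact: closed_eball.
by exists (fine (mu (eball z r))); [exact: fine_ge0|rewrite fineK].
Qed.

(** * Shells below the admissibility threshold *)

Section Small_shells.
Context {R : realType} {d : nat}.
Context (G : set ('rV[R]_d.+1 -> 'rV[R]_d.+1)) (H : 'rV[R]_d.+1 -> set 'rV[R]_d.+1).
Context (hH : standard_horoballs G H) (A0 tau C R1 A1 : R) (hA0 : 1 <= A0)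
  (htau : 0 < tau < 1) (hC : 0 < C < 1) (hA1 : 1 <= A1)
  (mud : probability (borel R d) R).
Implicit Types (z p q : 'rV[R]_d.+1) (r e s : R) (k : nat)
  (mu nu : probability (borel R d) R).
Local Notation P := (parabolic_points G).
Local Notation delta := (poincare_exponent G).
Local Open Scope ereal_scope.

Context (hadm : forall z r k,
  limit_set G z -> (0 < r < R1)%R -> (tau ^+ k < C * r ^+ 2)%R ->
  let w := (tau `^ (- (k%:R * delta)))%R in
  (A1^-1 * w)%:E * mud (eball z r) <= horoball_count G H tau z r k /\
  horoball_count G H tau z r k <= (A1 * w)%:E * mud (eball z r)).

Let A0_gt0 : (0 < A0)%R. Proof. exact: lt_le_trans hA0. Qed.
Let A1_gt0 : (0 < A1)%R. Proof. exact: lt_le_trans hA1. Qed.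
Let tau_gt0 : (0 < tau)%R. Proof. by case/andP: htau. Qed.
Let delta_ge0 : (0 <= delta)%R. Proof. exact: poincare_exponent_ge0. Qed.

(** Counts grow like [tau^(-k delta)] and atoms weigh about [tau^(k s)]: the shells form a geometric
    progression. *)
Lemma powR_shift s k : (tau `^ (- (k%:R * delta)) * tau `^ (k%:R * s) =
  (tau `^ (s - delta)) ^+ k)%R.
Proof.
rewrite -powRD ?(gt_eqF tau_gt0) ?implybT // -powR_mulrn ?powR_ge0 //.
by rewrite -powRrM; congr powR; ring.
Qed.

Lemma small_shell_measure_le s mu z r k : (delta < s)%R ->
  atoms_comparable G H A0 s mu -> limit_set G z -> (0 < r < R1)%R ->
  (tau ^+ k < C * r ^+ 2)%R ->
  mu (shell G H tau z r k) <=
    (A0 * A1)%:E * mud (eball z r) * ((tau `^ (s - delta)) ^+ k)%:E.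
Proof.
move=> ds atoms Lz r01 kr; have [_ le_count] := hadm Lz r01 kr.
have /andP[r0 _] := r01.
have s0 : (0 <= s)%R by rewrite (le_trans delta_ge0) // ltW.
apply: le_trans (shell_measure_le hH hA0 htau z k s0 r0 atoms) _.
have [m m0 mE] := probability_eball_fin mud z r; rewrite mE in le_count *.
apply: (@le_trans _ _ (A0%:E * ((A1 * tau `^ (- (k%:R * delta)))%:E *
    m%:E * (tau `^ (k%:R * s))%:E))).
  by rewrite lee_wpmul2l ?lee_fin ?(ltW A0_gt0) // lee_wpmul2r ?lee_fin ?powR_ge0.
by rewrite -!EFinM lee_fin -powR_shift le_eqVlt; apply/orP; left; apply/eqP; ring.
Qed.

Lemma small_shell_measure_ge s mu z r k : (delta < s)%R ->
  atoms_comparable G H A0 s mu -> limit_set G z -> (0 < r < R1)%R ->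
  (tau ^+ k < C * r ^+ 2)%R ->
  (A0^-1 * A1^-1 * tau `^ s)%:E * mud (eball z r) *
    ((tau `^ (s - delta)) ^+ k)%:E <= mu (shell G H tau z r k).
Proof.
move=> ds atoms Lz r01 kr; have [le_count _] := hadm Lz r01 kr.
have /andP[r0 _] := r01.
have s0 : (0 <= s)%R by rewrite (le_trans delta_ge0) // ltW.
apply: le_trans _ (shell_measure_ge hH hA0 htau z k s0 r0 atoms).
have [m m0 mE] := probability_eball_fin mud z r; rewrite mE in le_count *.
apply: (@le_trans _ _ ((A0^-1 * tau `^ s)%:E *
    ((A1^-1 * tau `^ (- (k%:R * delta)))%:E * m%:E *
     (tau `^ (k%:R * s))%:E))).
  by rewrite -!EFinM lee_fin -powR_shift le_eqVlt; apply/orP; left; apply/eqP; ring.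
rewrite lee_wpmul2l ?lee_fin ?mulr_ge0 ?invr_ge0 ?powR_ge0 ?(ltW A0_gt0) //.
by rewrite lee_wpmul2r ?lee_fin ?powR_ge0.
Qed.

(** One ball of positive [mud]-measure, fixed beforehand, serves for every [s]. Its shells
    [k0, ..., k0 + n] are disjoint and each has mass at least [K * x ^+ M]; for [x] above the bound
    their total would exceed 1. *)
Lemma ratio_bound : exists2 x0 : R, (0 < x0 < 1)%R &
  forall s mu z r, (delta < s)%R -> atoms_comparable G H A0 s mu ->
    limit_set G z -> (0 < r < R1)%R -> 0 < mud (eball z r) ->
    (tau `^ (s - delta) <= x0)%R.
Proof.
have half01 : (0 < 2^-1 :> R)%R && (2^-1 < 1 :> R)%R by apply/andP; split; lra.
have [[z0 [r0 [Lz0 r01 m0]]]|none] := pselect (exists z r,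
    [/\ limit_set G z, (0 < r < R1)%R & 0 < mud (eball z r)]); last first.
  exists 2^-1%R => // s mu z r _ _ Lz r01 m0; exfalso; apply: none.
  by exists z, r.
have [m _ mE] := probability_eball_fin mud z0 r0.
rewrite mE lte_fin in m0.
have /andP[r0_gt0 _] := r01; have /andP[C0 _] := hC.
have [k0 k0r] : exists k0, (tau ^+ k0 < C * r0 ^+ 2)%R.
  by apply: exists_expr_lt => //; rewrite mulr_gt0 ?exprn_gt0.
(* The factor [tau^s] of the lower bound is split as [tau^delta * x]: the first part enters [K], the
   second raises the exponent of [x] by one. *)
pose K : R := (A0^-1 * A1^-1 * m * tau `^ delta)%R.
have K0 : (0 < K)%R by rewrite !mulr_gt0 ?invr_gt0 ?powR_gt0.
have [n nK] : exists n : nat, (2 < K * n.+1%:R)%R.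
  exists (Num.truncn (2 / K)).
  by rewrite mulrC -ltr_pdivrMr //; exact: truncnS_gt.
(* The largest exponent of [x] over the chosen shells. With [y = 1 - 1 / (2M)], Bernoulli's
   inequality gives [y ^+ M >= 1/2]. *)
pose M := (k0 + n.+1)%N.
have M1 : (1 <= M%:R :> R)%R by rewrite ler1n /M addnS.
pose y : R := (1 - (2 * M%:R)^-1)%R.
have y0 : ((0 : R) < (2 * M%:R)^-1)%R by rewrite invr_gt0; lra.
have y1 : ((2 * M%:R)^-1 <= 2^-1 :> R)%R by rewrite lef_pV2 ?posrE; lra.
exists y; first by rewrite /y; apply/andP; split; lra.
move=> s mu z r ds atoms _ _ _; rewrite leNgt; apply/negP => yx.
set x := (tau `^ (s - delta))%R in yx.
have x01 : (0 < x <= 1)%R.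
  rewrite powR_gt0 //= -(powRr0 tau); apply: ger_powR; last by rewrite subr_ge0 ltW.
  by case/andP: htau => -> /ltW.
have xM : (2^-1 <= x ^+ M)%R.
  apply: (@le_trans _ _ (y ^+ M)%R); last first.
    by rewrite lerXn2r ?nnegrE ?(ltW yx) //; [rewrite /y|]; lra.
  apply: le_trans (bernoulli_le M _); last by apply/andP; split; lra.
  by rewrite invfM mulrCA divff ?mulr1 ?gt_eqF //; lra.
pose F (i : 'I_n.+1) := shell G H tau z0 r0 (k0 + i).
have mF i : measurable (F i : set (borel R d)) by exact: measurable_shell.
have tF : trivIset setT F.
  move=> i j _ _ Fij; apply/ord_inj/(@addnI k0).
  exact: (@trivIset_shell _ _ G H tau z0 r0 setT htau).
have : (n.+1%:R * (K * x ^+ M))%:E <= mu (\big[setU/set0]_(i < n.+1) F i).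
  rewrite measure_bigsetU_ord //.
  have -> : (n.+1%:R * (K * x ^+ M) = \sum_(i < n.+1) K * x ^+ M)%R.
    by rewrite sumr_const card_ord mulr_natl.
  rewrite -sumEFin; apply: lee_sum => i _.
  apply: le_trans (small_shell_measure_ge ds atoms Lz0 r01 _); last first.
    apply: le_lt_trans k0r; rewrite ler_iXn2l ?leq_addr //.
    by case/andP: htau.
  rewrite mE -!EFinM lee_fin -/x.
  have -> : (tau `^ s = tau `^ delta * x)%R.
    by rewrite -powRD ?subrKC // (gt_eqF tau_gt0) implybT.
  have -> : (A0^-1 * A1^-1 * (tau `^ delta * x) * m * x ^+ (k0 + i) =
     K * x ^+ (k0 + i).+1)%R by rewrite exprS /K; ring.
  have /andP[x0 x1] := x01.
  rewrite ler_pM2l //; apply: ler_wiXn2l => //; first exact: ltW.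
  by rewrite -addnS leq_add2l; exact: ltn_ord.
have le1 : mu (\big[setU/set0]_(i < n.+1) F i) <= 1.
  by apply: probability_le1; apply: bigsetU_measurable.
move=> /le_trans/(_ le1); rewrite lee_fin leNgt => /negP; apply.
have : (K * n.+1%:R * 2^-1 <= K * n.+1%:R * x ^+ M)%R.
  by apply: ler_wpM2l => //; rewrite mulr_ge0 // ltW.
rewrite mulrCA mulrA; apply: lt_le_trans.
by rewrite ltr_pdivlMr // mul1r.
Qed.

(** The first shell below the threshold alone gives the lower bound; the upper one sums the
    geometric series. *)
Lemma tail_measure_bounds (s1 x0 : R) : (0 < x0 < 1)%R ->
  forall s mu z r, (delta < s)%R -> (s <= s1)%R ->
    atoms_comparable G H A0 s mu -> limit_set G z -> (0 < r < R1)%R -> (r <= 1)%R ->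
    (0 < mud (eball z r) -> (tau `^ (s - delta) <= x0)%R) ->
    let tail := \esum_(k in [set k | (tau ^+ k < C * r ^+ 2)%R])
      mu (shell G H tau z r k) in
    let main := (r `^ (2 * (s - delta)))%:E * mud (eball z r) in
    (A0^-1 * A1^-1 * tau `^ s1 * (tau * C) `^ (s1 - delta))%:E * main <= tail /\
    tail <= (A0 * A1 / (1 - x0))%:E * main.
Proof.
move=> /andP[x0_gt0 x0_lt1] s mu z r ds ss1 atoms Lz rR1 r1 ratio tail main.
have /andP[r0 _] := rR1; have /andP[C0 C1] := hC; have /andP[_ tau1] := htau.
have a0 : (0 < s - delta)%R by rewrite subr_gt0.
have pow_k k : ((tau `^ (s - delta)) ^+ k = (tau ^+ k) `^ (s - delta))%R.
  by rewrite -powR_mulrn ?powR_ge0 // powRAC powR_mulrn // ltW.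
have pow_r : (r `^ (2 * (s - delta)) = (r ^+ 2) `^ (s - delta))%R.
  by rewrite powRrM powR_mulrn // ltW.
have Cr : (0 < C * r ^+ 2 <= 1)%R.
  rewrite mulr_gt0 ?exprn_gt0 //= mulr_ile1 ?exprn_ile1 ?exprn_ge0 //;
    exact: ltW.
(* [n.+1] is the first index below the threshold, and [tau ^+ n.+1] is still at least
   [tau * C * r ^+ 2]. *)
have [n /andP[n1 n2]] := expr_bracket_gt htau Cr.
have [m m0 mE] := probability_eball_fin mud z r.
rewrite /main mE -!EFinM; split.
  apply: (@le_trans _ _ (mu (shell G H tau z r n.+1))); last first.
    apply: esum_ge; exists [set n.+1]; last by rewrite fsbig_set1.
    by split; [exact: finite_set1|move=> k ->].
  apply: le_trans (small_shell_measure_ge ds atoms Lz rR1 n1).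
  rewrite mE -!EFinM lee_fin pow_k pow_r.
  (* Powers of a base at most 1 decrease with the exponent, so replacing [s] by [s1] gives lower
     bounds free of [s]. *)
  have le_tau : (tau `^ s1 <= tau `^ s)%R 
    by apply: ger_powR ss1; rewrite tau_gt0 ltW.
  have le_tauC : ((tau * C) `^ (s1 - delta) <= (tau * C) `^ (s - delta))%R.
    apply: ger_powR; last by rewrite lerD2r.
    by rewrite mulr_gt0 //= mulr_ile1 ?(ltW tau_gt0) ?(ltW tau1) ?(ltW C0) ?(ltW C1).
  have le_n : ((tau * C) `^ (s - delta) * (r ^+ 2) `^ (s - delta)
      <= (tau ^+ n.+1) `^ (s - delta))%R.
    rewrite -powRM ?mulr_ge0 ?exprn_ge0 ?(ltW tau_gt0) ?(ltW C0) ?(ltW r0) //.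
    apply: ge0_ler_powR;
      rewrite ?nnegrE ?mulr_ge0 ?exprn_ge0 ?(ltW tau_gt0) ?(ltW C0) ?(ltW r0)
        ?(ltW a0) //.
    by rewrite -mulrA (exprS tau) ler_pM2l.
  have regroup (a b p q t : R) :
      (a * b * p * q * (t * m) = a * b * m * (p * (q * t)))%R.
    by ring.
  rewrite regroup (_ : (A0^-1 * A1^-1 * tau `^ s * m * (tau ^+ n.+1) `^ (s - delta)
    = A0^-1 * A1^-1 * m * (tau `^ s * (tau ^+ n.+1) `^ (s - delta)))%R); last by ring.
  apply: ler_wpM2l; first by rewrite !mulr_ge0 ?invr_ge0 ?(ltW A0_gt0) ?(ltW A1_gt0).
  apply: ler_pM => //; rewrite ?mulr_ge0 ?powR_ge0 //.
  by apply: le_trans _ le_n; apply: ler_wpM2r => //; exact: powR_ge0.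
have up k : (tau ^+ k < C * r ^+ 2)%R -> mu (shell G H tau z r k) <=
    (A0 * A1 * m)%:E * ((tau `^ (s - delta)) ^+ k)%:E.
  by move=> kr; have := small_shell_measure_le ds atoms Lz rR1 kr; rewrite mE -EFinM.
apply: (@le_trans _ _ ((A0 * A1 * m)%:E *
    \esum_(k in [set k | (tau ^+ k < C * r ^+ 2)%R])
      ((tau `^ (s - delta)) ^+ k)%:E)).
  rewrite -esumZl.
  - by apply: le_esum => k; exact: up.
  - by rewrite !mulr_ge0 ?(ltW A0_gt0) ?(ltW A1_gt0).
  - by move=> k _; rewrite lee_fin exprn_ge0 ?powR_ge0.
(* The ratio is controlled only when the ball has positive measure; on a null ball both sides
   vanish. *)
have [m_eq0|m_neq0] := eqVneq m 0%R; first by rewrite m_eq0 !mulr0 mul0e.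
have m_gt0 : (0 < m)%R by rewrite lt_def m_neq0.
have xx0 : (tau `^ (s - delta) <= x0)%R by apply: ratio; rewrite mE lte_fin.
apply: (@le_trans _ _ ((A0 * A1 * m)%:E *
    ((tau `^ (s - delta)) ^+ n.+1 / (1 - tau `^ (s - delta)))%:E)).
  rewrite lee_wpmul2l ?lee_fin ?mulr_ge0 ?(ltW A0_gt0) ?(ltW A1_gt0) //.
  apply: esum_geometric_le; first by rewrite powR_ge0 (le_lt_trans xx0).
  by move=> k /lt_le_trans/(_ n2); exact: ltr_expn2l_imp.
rewrite -EFinM lee_fin (_ : (A0 * A1 / (1 - x0) * (r `^ (2 * (s - delta)) * m)
  = A0 * A1 * m * (r `^ (2 * (s - delta)) / (1 - x0)))%R); last by ring.
apply: ler_wpM2l; first by rewrite !mulr_ge0 ?(ltW A0_gt0) ?(ltW A1_gt0).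
apply: ler_pM; rewrite ?exprn_ge0 ?powR_ge0 ?invr_ge0 ?subr_ge0 //.
- by apply: le_trans xx0 (ltW _).
- rewrite pow_k pow_r; apply: ge0_ler_powR;
    rewrite ?nnegrE ?exprn_ge0 ?(ltW tau_gt0) ?(ltW r0) ?(ltW a0) //.
  by rewrite (le_trans (ltW n1)) // ger_pMl ?exprn_gt0 ?(ltW C1).
- by rewrite lef_pV2 ?posrE ?subr_gt0 ?lerD2l ?lerN2 // (le_lt_trans xx0).
Qed.

End Small_shells.

(** * A common constant and the assembly of the three estimates *)

Lemma scale_bounds (R : realType) (A c c' : R) (g v : \bar R) :
  0 < c -> c^-1 <= A -> c' <= A -> (0 <= g)%E ->
  (c%:E * g <= v /\ v <= c'%:E * g -> A^-1%:E * g <= v /\ v <= A%:E * g)%E.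
Proof.
move=> c0 cA c'A g0 [lo up]; split.
  apply: le_trans lo; rewrite lee_wpmul2r // lee_fin -(invrK c).
  by rewrite lef_pV2 ?posrE ?invr_gt0 // (lt_le_trans _ cA) ?invr_gt0.
by apply: le_trans up _; rewrite lee_wpmul2r // lee_fin.
Qed.

Theorem theorem2p8 (R : realType) (d : nat) (hd : (1 <= d)%N)
    (Gamma : set ('rV[R]_d.+1 -> 'rV[R]_d.+1))
    (hK : kleinian Gamma) (hne : non_elementary Gamma)
    (hgf : geometrically_finite Gamma)
    (hpar : exists2 g, Gamma g & exists p, parabolic_at g p)
    (H : 'rV[R]_d.+1 -> set 'rV[R]_d.+1) (hH : standard_horoballs Gamma H)
    (mu_delta : probability (borel R d) R)
    (hconf : conformal Gamma (poincare_exponent Gamma) mu_delta)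
    (hsupp : supported_on (limit_set Gamma) mu_delta)
    (A0 : R) (hA0 : 1 <= A0)
    (tau C : R) (htau : 0 < tau < 1) (hC : 0 < C < 1)
    (hadm : admissible Gamma H mu_delta tau C) :
  exists R0 : R, exists A : R, [/\ 0 < R0, 1 <= A &
    forall (s : R) (mu_s : probability (borel R d) R),
      poincare_exponent Gamma < s ->
      conformal Gamma s mu_s ->
      supported_on (limit_set Gamma) mu_s ->
      purely_atomic_on (parabolic_points Gamma) mu_s ->
      atoms_comparable Gamma H A0 s mu_s ->
      forall (z : 'rV[R]_d.+1) (r : R), limit_set Gamma z -> 0 < r < R0 ->
        (A^-1%:E * G_s Gamma H mu_delta tau C s z r <= mu_s (eball z r) /\
         mu_s (eball z r) <= A%:E * G_s Gamma H mu_delta tau C s z r)%E].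
Proof.
have [R1 [A1 [R1_gt0 hA1 hadm1]]] := hadm.
have [s1 s_le] := exponent_upper_bound hH hA0 htau.
have [x0 /[dup] x01 /andP[x0_gt0 x0_lt1] ratio] := ratio_bound hH hA0 htau hC hA1 hadm1.
have [N N_gt0 large_bounds] := large_measure_bounds hH hA0 htau.
set delta := poincare_exponent Gamma in ratio *.
have delta_ge0 : 0 <= delta by exact: poincare_exponent_ge0.
have A0_gt0 : 0 < A0 by exact: lt_le_trans hA0.
have A1_gt0 : 0 < A1 by exact: lt_le_trans hA1.
have /andP[tau_gt0 tau_lt1] := htau; have /andP[C_gt0 C_lt1] := hC.
(* [c1] and [c1'] bound the tail from below and above; [c2] bounds the middle shells from below. *)
pose c1 := A0^-1 * A1^-1 * tau `^ s1 * (tau * C) `^ (s1 - delta).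
pose c1' := A0 * A1 / (1 - x0).
pose c2 := A0^-1 * tau `^ s1.
have c1_gt0 : 0 < c1 by rewrite !mulr_gt0 ?invr_gt0 ?powR_gt0 ?mulr_gt0.
have c1'_gt0 : 0 < c1' by rewrite !mulr_gt0 ?invr_gt0 ?subr_gt0.
have c2_gt0 : 0 < c2 by rewrite mulr_gt0 ?invr_gt0 ?powR_gt0.
have c1V : 0 < c1^-1 by rewrite invr_gt0.
have c2V : 0 < c2^-1 by rewrite invr_gt0.
have NA0 : 0 < N * A0 by rewrite mulr_gt0.
(* The sum dominates every upper constant and the inverse of every lower one. *)
pose A := 1 + c1^-1 + c1' + c2^-1 + A0 + N * A0.
have A_ge1 : 1 <= A by rewrite /A; lra.
have [Ac1 Ac1' Ac2 AA0 ANA0] :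
    [/\ c1^-1 <= A, c1' <= A, c2^-1 <= A, A0 <= A & N * A0 <= A].
  by rewrite /A; split; lra.
(* [R1] is the range of admissibility; radii below 1 rule out negative exponents and give
   [C * r ^+ 2 < r]. *)
exists (Num.min R1 1), A; split; [by rewrite lt_min R1_gt0 ltr01|exact: A_ge1|].
move=> s mu ds _ _ [muP _] atoms z r Lz; rewrite lt_min => /andP[r0 /andP[rR1 r1]].
have ss1 : s <= s1 by exact: s_le muP atoms.
have s0 : 0 <= s by apply: le_trans delta_ge0 (ltW ds).
have r01 : 0 < r <= 1 by rewrite r0 ltW.
have r0R1 : 0 < r < R1 by rewrite r0.
rewrite (measure_eball_shells hH z htau r01 muP).
(* [D] separates the middle shells from those governed by admissibility. *)
pose D := [set k | C * r ^+ 2 <= tau ^+ k].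
rewrite (@esumID R nat D) //.
have -> : [set k | tau ^+ k < r] `&` D = [set k | C * r ^+ 2 <= tau ^+ k < r].
  by apply/seteqP; split=> k /=; [move=> [-> ->]|move=> /andP[]].
have -> : [set k | tau ^+ k < r] `&` ~` D = [set k | tau ^+ k < C * r ^+ 2].
  apply/seteqP; split=> k; rewrite /D /=; first by move=> [_ /negP]; rewrite -ltNge.
  move=> kr; split; last by apply/negP; rewrite -ltNge.
  apply: (lt_trans kr); apply: (@lt_trans _ _ (r ^+ 2)).
    by rewrite gtr_pMl ?exprn_gt0.
  by rewrite expr2 gtr_pMl.
have main_ge0 : (0 <= (r `^ (2 * (s - delta)))%:E * mu_delta (eball z r))%E.
  by rewrite mule_ge0 // lee_fin powR_ge0.
pose K := [set k : nat | C * r ^+ 2 <= tau ^+ k < r].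
pose g := (\esum_(k in K)
  (horoball_count Gamma H tau z r k * (tau `^ (k%:R * s))%:E))%E.
have count_ge0 k :
    (0 <= horoball_count Gamma H tau z r k * (tau `^ (k%:R * s))%:E)%E.
  by rewrite mule_ge0 ?counting_ge0 // lee_fin powR_ge0.
have mid_ge0 : (0 <= g)%E by exact: esum_ge0.
have large_ge0 : (0 <= (large_term Gamma H tau s z r)%:E)%E.
  rewrite lee_fin /large_term; case: xgetP => // _ _ [p _ <-].
  exact: powR_ge0.
have tail := tail_measure_bounds hH hA0 htau hC hA1 hadm1 x01 ds ss1 atoms
  Lz r0R1 (ltW r1) (ratio s mu z r ds atoms Lz r0R1).
pose v := (\esum_(k in K) mu (shell Gamma H tau z r k))%E.
have mid : (c2%:E * g <= v /\ v <= A0%:E * g)%E.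
  rewrite /g -!esumZl ?(ltW c2_gt0) ?(ltW A0_gt0) //; split; apply: le_esum => k _.
    apply: le_trans (shell_measure_ge hH hA0 htau z k s0 r0 atoms).
    rewrite lee_wpmul2r // lee_fin ler_wpM2l ?invr_ge0 ?(ltW A0_gt0) //.
    by apply: ger_powR ss1; rewrite tau_gt0 ltW.
  exact: shell_measure_le.
have [tail_lo tail_up] := scale_bounds c1_gt0 Ac1 Ac1' main_ge0 tail.
have [mid_lo mid_up] := scale_bounds c2_gt0 Ac2 AA0 mid_ge0 mid.
have A0V : A0^-1^-1 <= A by rewrite invrK.
have A0V_gt0 : 0 < A0^-1 by rewrite invr_gt0.
have [large_lo large_up] := scale_bounds A0V_gt0 A0V ANA0 large_ge0
  (large_bounds s mu z r s0 r01 atoms).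
(* The measure is split as large + (middle + tail), while [G_s] lists tail, middle, large; the terms
   are reordered to be compared one by one. *)
rewrite [X in _ /\ (X <= _)%E]addeC [X in (_ <= X)%E /\ _]addeC /G_s.
rewrite !ge0_muleDr ?adde_ge0 //; split; apply: leeD => //.
  by rewrite addeC; exact: leeD.
by rewrite addeC; exact: leeD.
Qed.
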